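(* Consider a submodular SDM $\mathcal{G}(V,H)$ on $n$ nodes that for some $c\ge1$ satisfies, for every $T\subset V$, the variance bound $$\operatorname{Var}[R^\tau(T)]\le c\,I^\tau(T)\max\Big\{I^\tau(T),\max_{v\in V}I^\tau(\{v\})\Big\}.$$ Let $\epsilon,\delta\in(0,1)$ and $1\le s\le n$. Consider a median-of-averages oracle constructed with $O(\epsilon^{-2}s^3c\ln\frac n\delta)$ simulations of $\mathcal{G}$ arranged as $O(s\ln\frac n\delta)$ pools with $O(\epsilon^{-2}s^2c)$ simulations each (for suitable absolute constants). Then with probability at least $1-\delta$, the set $T$ that contains the first $s$ nodes returned by greedy on the oracle satisfies $$I^\tau(T)\ge\big(1-(1-1/s)^s\big)(1-\epsilon)\,\mathrm{OPT}^\tau_s.$$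
   Context: $V$ is a finite set, $|V|=n$. A stochastic diffusion model (SDM) $\mathcal{G}(V,H)$ is a distribution over families $\phi=(\phi_v)_{v\in V}$ of monotone non-decreasing functions $\phi_v:2^{V\setminus\{v\}}\to\{0,1\}$, with a utility $H:2^V\to\mathbb{R}_{\ge0}$, monotone non-decreasing, $H(\emptyset)=0$. A simulation is a draw $\phi\sim\mathcal{G}$. $\mathrm{Reach}^0(\phi,S)=S$, $\mathrm{Reach}^{t+1}(\phi,S)=\mathrm{Reach}^t(\phi,S)\cup\{v\notin\mathrm{Reach}^t(\phi,S):\phi_v(\mathrm{Reach}^t(\phi,S))=1\}$. $R^\tau(S)=H(\mathrm{Reach}^\tau(\phi,S))$, $I^\tau(S)=\mathbb{E}[R^\tau(S)]$, $\mathrm{OPT}^\tau_s=\max_{|S|\le s}I^\tau(S)$. The SDM is submodular if the set function $I^\tau$ is submodular. A median-of-averages oracle with $r$ pools of $\ell$ simulations is built from $r\ell$ i.i.d. simulations $\phi_{ij}$ ($i\le r$, $j\le\ell$) and is the set function $T\mapsto\mathrm{Median}_{i\le r}\ \frac1\ell\sum_{j=1}^\ell H(\mathrm{Reach}^\tau(\phi_{ij},T))$. Greedy on a set function $\hat F$ starts with $S=\emptyset$ and at each step adds to $S$ a node $u$ maximizing $\hat F(S\cup\{u\})-\hat F(S)$. *)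

(* Defs.v *)
From HB Require Import structures.
From mathcomp Require Import all_boot all_order all_algebra.
From mathcomp Require Import boolp reals exp.
Set Implicit Arguments.
Unset Strict Implicit.
Unset Printing Implicit Defensive.
Import Order.TTheory GRing.Theory Num.Theory.
Local Open Scope ring_scope.

Definition activation (V : finType) (v : V) : finType :=
  {ffun {set {u : V | u != v}} -> bool}.

Definition family (V : finType) : finType :=
  {dffun forall v : V, activation v}.

Definition monotone_family (V : finType) (phi : family V) : bool :=
  [forall v : V, forall A : {set {u : V | u != v}},
     forall B : {set {u : V | u != v}},
       (A \subset B) ==> (phi v A ==> phi v B)].

Definition simulation (V : finType) : finType :=
  {phi : family V | monotone_family phi}.

(* There are finitely many families, so every distribution over them is given
   by a probability mass function. *)
Record sdm (R : realType) (V : finType) := Sdm {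
  sdm_pmf : simulation V -> R;
  sdm_pmf_ge0 : forall phi, 0 <= sdm_pmf phi;
  sdm_pmf_sum1 : \sum_(phi : simulation V) sdm_pmf phi = 1;
  sdm_utility : {set V} -> R;
  sdm_utility_ge0 : forall A, 0 <= sdm_utility A;
  sdm_utility_mono : forall A B : {set V}, A \subset B -> sdm_utility A <= sdm_utility B;
  sdm_utility_set0 : sdm_utility set0 = 0 }.

(* For v outside A, the preimage of A under val is A itself, viewed as a set of
   nodes other than v. *)
Fixpoint reach (V : finType) (phi : simulation V) (S : {set V}) (t : nat) :
    {set V} :=
  if t is t'.+1 then
    let A := reach phi S t' in
    A :|: [set v : V | (v \notin A) && val phi v (val @^-1: A)]
  else S.

Section Influence.
Context (R : realType) (V : finType) (G : sdm R V) (tau : nat).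

Definition sim_expectation (X : simulation V -> R) : R :=
  \sum_(phi : simulation V) sdm_pmf G phi * X phi.

Definition sim_variance (X : simulation V -> R) : R :=
  sim_expectation (fun phi => (X phi - sim_expectation X) ^+ 2).

Definition reward (T : {set V}) (phi : simulation V) : R :=
  sdm_utility G (reach phi T tau).

Definition influence (T : {set V}) : R := sim_expectation (reward T).

(* Influence is nonnegative, so the default value 0 does not affect the maxima
   in opt and max_influence1. *)
Definition opt (s : nat) : R :=
  \big[Num.max/0]_(S : {set V} | (#|S| <= s)%N) influence S.

Definition max_influence1 : R := \big[Num.max/0]_(v : V) influence [set v].

End Influence.

Definition submodular (R : realType) (V : finType) (F : {set V} -> R) : Prop :=
  forall A B : {set V}, F (A :|: B) + F (A :&: B) <= F A + F B.

(* For an even number of values, the mean of the two middle ones. *)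
Definition median (R : realType) (xs : seq R) : R :=
  let ys := sort <=%R xs in
  (ys`_((size xs).-1./2) + ys`_((size xs)./2)) / 2.

Section Oracle.
Context (R : realType) (V : finType) (G : sdm R V) (tau r l : nat).

Definition sample : finType := {ffun 'I_r * 'I_l -> simulation V}.

(* Probability under the product distribution, i.e. the r * l simulations in w
   are independent draws from G. *)
Definition sample_prob (E : sample -> Prop) : R :=
  \sum_(w : sample | `[< E w >]) \prod_(ij : 'I_r * 'I_l) sdm_pmf G (w ij).

Definition oracle (w : sample) (T : {set V}) : R :=
  median [seq (\sum_(j < l) reward G tau T (w (i, j))) / l%:R | i : 'I_r].

End Oracle.

(* greedy_set F k S: S consists of the first k nodes selected by some run of
   greedy on F, with ties broken arbitrarily. *)
Inductive greedy_set (R : realType) (V : finType) (F : {set V} -> R) :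
    nat -> {set V} -> Prop :=
| greedy_start : greedy_set F 0 set0
| greedy_step (k : nat) (S : {set V}) (u : V) :
    greedy_set F k S ->
    u \notin S ->
    (forall v : V, v \notin S -> F (v |: S) - F S <= F (u |: S) - F S) ->
    greedy_set F k.+1 (u |: S).

(* Main.v *)
Require Import Defs.
From HB Require Import structures.
From mathcomp Require Import all_boot all_order all_algebra.
From mathcomp Require Import boolp reals sequences exp.
From mathcomp Require Import zify ring lra.
Set Implicit Arguments.
Unset Strict Implicit.
Unset Printing Implicit Defensive.
Import Order.TTheory GRing.Theory Num.Theory.
Local Open Scope ring_scope.

(** Put [e := eps * OPT / (2 s)]. If the oracle is within [e] of the influence
    on every nonempty set of at most [s] nodes, each greedy step closes a
    fraction [1 / s] of the gap to OPT up to a loss of [2 e]; the losses sum to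
    at most [(1 - (1 - 1/s)^s) 2 s e = (1 - (1 - 1/s)^s) eps OPT].
    For a fixed set both influences in the variance bound are at most OPT, so
    by Chebyshev a pool average is off by more than [e] with probability at
    most [1/64]. The median is off only if half of the [r] pools are, which has
    probability at most [2^r 64^(-r/2) = 4^-r <= exp (- r) <= (delta / n)^s],
    and a union bound over at most [n^s] sets concludes. *)

(** * Monotonicity of reach and influence, and comparison with OPT *)

Lemma reach_subset (V : finType) (phi : simulation V) (S T : {set V}) t :
  S \subset T -> reach phi S t \subset reach phi T t.
Proof.
move=> sST; elim: t => [//|t /subsetP IH] /=.
set A := reach phi S t in IH *; set B := reach phi T t in IH *.
apply/subsetP => v; rewrite !inE => /orP[/IH-> //|/andP[_ phiA]].
(* If [v] is not yet in [B], monotonicity of [phi v] carries its activation from the trace of [A] to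
   that of [B]. *)
case: (boolP (v \in B)) => //= _.
have /forallP/(_ v)/forallP/(_ (val @^-1: A))/forallP/(_ (val @^-1: B)) := valP phi.
move=> /implyP/(_ _)/implyP; apply => //.
by apply/subsetP => u; rewrite !inE; apply: IH.
Qed.

Section InfluenceOrder.
Context (R : realType) (V : finType) (G : sdm R V) (tau : nat).

Lemma influence_ge0 T : 0 <= influence G tau T.
Proof.
by apply: sumr_ge0 => phi _; rewrite mulr_ge0 ?sdm_pmf_ge0 ?sdm_utility_ge0.
Qed.

Lemma influence_mono (S T : {set V}) :
  S \subset T -> influence G tau S <= influence G tau T.
Proof.
move=> sST; apply: ler_sum => phi _.
by rewrite ler_wpM2l ?sdm_pmf_ge0 ?sdm_utility_mono ?reach_subset.
Qed.

Lemma influence_le_opt s (T : {set V}) :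
  (#|T| <= s)%N -> influence G tau T <= opt G tau s.
Proof. by move=> leTs; apply: le_bigmax_cond. Qed.

Lemma max_influence1_le_opt s :
  (0 < s)%N -> max_influence1 G tau <= opt G tau s.
Proof.
move=> s_gt0; apply: bigmax_le => [|v _]; first exact: bigmax_ge_id.
by rewrite influence_le_opt ?cards1.
Qed.

End InfluenceOrder.

(** * Greedy maximization with an inexact oracle *)

Section Greedy.
Context (R : realType) (V : finType) (F : {set V} -> R).
Hypotheses (subF : submodular F)
  (monoF : forall A B : {set V}, A \subset B -> F A <= F B).

(** Elements of [O] join [S] one at a time, and by submodularity each gains at most its marginal at
    [S]. The induction runs over lists; an element already present causes no trouble, since only
    [F S <= F (_ :&: _)] is asked of the intersection. *)
Lemma submodular_sum_marginals (S O : {set V}) :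
  F O - F S <= \sum_(v in O) (F (v |: S) - F S).
Proof.
suff H (l : seq V) :
    F ([set x in l] :|: S) - F S <= \sum_(v <- l) (F (v |: S) - F S).
  rewrite -big_enum; apply: le_trans (H _); rewrite lerB ?monoF //.
  by apply/subsetP => x xO; rewrite !inE mem_enum xO.
elim: l => [|x l IH].
  by rewrite big_nil (_ : [set x in [::]] = set0) ?set0U ?subrr //.
rewrite big_cons set_cons.
have := subF (x |: S) ([set y in l] :|: S).
have -> : (x |: S) :|: ([set y in l] :|: S) = x |: [set y in l] :|: S.
  by rewrite setUACA setUid.
have : F S <= F ((x |: S) :&: ([set y in l] :|: S)).
  by rewrite monoF // subsetI !subsetUr.
move: IH; lra.
Qed.

Context (Fh : {set V} -> R) (s : nat) (eta : R).
Hypotheses (F_ge0 : forall A, 0 <= F A) (s_gt0 : (0 < s)%N) (eta_ge0 : 0 <= eta)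
  (accurate : forall T : {set V},
     T != set0 -> (#|T| <= s)%N -> `|Fh T - F T| <= eta).

Lemma greedy_set_card k T : greedy_set Fh k T -> #|T| = k.
Proof.
elim=> [|{}k S u _ cS uS _]; first by rewrite cards0.
by rewrite cardsU1 uS cS.
Qed.

(** In the greedy comparison [Fh S] cancels, so only the errors at [v |: S] and [u |: S] enter,
    whence [2 * eta]. This is why accuracy on nonempty sets suffices, even for the first step. *)
Lemma greedy_step_gain (k : nat) (S O : {set V}) (u : V) :
  (k < s)%N -> #|S| = k -> u \notin S -> (#|O| <= s)%N ->
  (forall v : V, v \notin S -> Fh (v |: S) - Fh S <= Fh (u |: S) - Fh S) ->
  F O - F S <= s%:R * (F (u |: S) - F S + 2 * eta).
Proof.
move=> ltks cS uS cO best; apply: (le_trans (submodular_sum_marginals S O)).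
have gain_ge0 : F S <= F (u |: S) by rewrite monoF ?subsetUr.
apply: (@le_trans _ _ (\sum_(v in O) (F (u |: S) - F S + 2 * eta))); last first.
  rewrite sumr_const -[leLHS]mulr_natl ler_wpM2r ?ler_nat //.
  by move: gain_ge0 eta_ge0; lra.
apply: ler_sum => v _.
have [vS|vS] := boolP (v \in S).
  (* Such a [v] has marginal zero, and the right side is nonnegative. *)
  rewrite (_ : v |: S = S); last by apply/setUidPr; rewrite sub1set.
  by move: gain_ge0 eta_ge0; lra.
have acc w : w \notin S -> `|Fh (w |: S) - F (w |: S)| <= eta.
  move=> wS; apply: accurate; last by rewrite cardsU1 wS cS.
  by apply/set0Pn; exists w; rewrite setU11.
move: (acc u uS) (acc v vS) (best v vS); rewrite !ler_norml.
by move=> /andP[? ?] /andP[? ?]; lra.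
Qed.

(** A step gives [F (u |: S) >= (1 - 1/s) * F S + F O / s - 2 * eta]. The fixed point of this affine
    recursion is [F O - 2 * s * eta], and the distance to it shrinks by [1 - 1/s] each time. *)
Lemma greedy_approx k (T O : {set V}) :
  (k <= s)%N -> greedy_set Fh k T -> (#|O| <= s)%N ->
  (1 - (1 - s%:R^-1) ^+ k) * (F O - 2 * s%:R * eta) <= F T.
Proof.
move=> lks gT cO; elim: gT lks => [|{}k S u gS IH uS best] lks.
  by rewrite expr0 subrr mul0r.
have := greedy_step_gain lks (greedy_set_card gS) uS cO best.
have {}IH := IH (ltnW lks).
have s0 : 0 < s%:R :> R by rewrite ltr0n.
have s1 : s%:R^-1 <= 1 :> R by rewrite invf_le1 ?ler1n.
rewrite mulrC -ler_pdivrMr // => step.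
have : (1 - s%:R^-1) * ((1 - (1 - s%:R^-1) ^+ k) * (F O - 2 * s%:R * eta))
       <= (1 - s%:R^-1) * F S by rewrite ler_wpM2l ?subr_ge0.
have -> : (1 - (1 - s%:R^-1) ^+ k.+1) * (F O - 2 * s%:R * eta) =
  (1 - s%:R^-1) * ((1 - (1 - s%:R^-1) ^+ k) * (F O - 2 * s%:R * eta))
  + (F O / s%:R - 2 * eta).
  by rewrite exprS; field; rewrite lt0r_neq0.
by move: step; lra.
Qed.

End Greedy.

(** * Order statistics and the median *)

Section Median.
Context (R : realType).
Implicit Types (xs : seq R) (a b : R).

(** Were the entry at position [k] below [a], so would be all [k.+1] sorted entries up to it. *)
Lemma nth_sort_ge xs a k : (k < size xs)%N ->
  (count (fun x => (x < a)%R) xs <= k)%N -> a <= (sort <=%R xs)`_k.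
Proof.
move=> ltk; rewrite leNgt -(count_sort <=%R) => cnt; apply/negP => lta.
have srt : sorted <=%R (sort <=%R xs) by apply/sort_sorted/le_total.
suff : (k.+1 <= count (fun x => (x < a)%R) (sort <=%R xs))%N by rewrite ltnNge cnt.
rewrite -(cat_take_drop k.+1 (sort _ _)) count_cat.
have szt : size (take k.+1 (sort <=%R xs)) = k.+1 by rewrite size_takel ?size_sort.
have /[!all_count]/eqP-> : all (fun x => x < a) (take k.+1 (sort <=%R xs)).
  apply/(all_nthP 0) => i; rewrite szt => lti; rewrite nth_take //.
  apply: le_lt_trans lta; apply: (sorted_leq_nth le_trans) => //.
    by rewrite inE size_sort (leq_trans lti).
  by rewrite inE size_sort.
by rewrite szt leq_addr.
Qed.

Lemma nth_sort_le xs b k :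
  (count (fun x => (b < x)%R) xs + k < size xs)%N -> (sort <=%R xs)`_k <= b.
Proof.
move=> cnt; rewrite leNgt; apply/negP => ltb.
have ltk : (k < size xs)%N := leq_ltn_trans (leq_addl _ _) cnt.
have srt : sorted <=%R (sort <=%R xs) by apply/sort_sorted/le_total.
suff : (size xs - k <= count (fun x => (b < x)%R) (sort <=%R xs))%N.
  by rewrite count_sort leq_subLR addnC leqNgt cnt.
rewrite -(cat_take_drop k (sort _ _)) count_cat.
have /[!all_count]/eqP-> : all (fun x => b < x) (drop k (sort <=%R xs)).
  apply/(all_nthP 0) => i; rewrite size_drop size_sort ltn_subRL => lti.
  rewrite nth_drop; apply: lt_le_trans ltb _.
  by apply: (sorted_leq_nth le_trans); rewrite ?inE ?size_sort ?leq_addr.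
by rewrite size_drop size_sort leq_addl.
Qed.

Lemma median_between xs a b :
  ((count (fun x => ~~ (a <= x <= b)%R) xs).*2 < size xs)%N ->
  a <= median xs <= b.
Proof.
set bad := count _ _ => cnt.
have cntl : (count (fun x => (x < a)%R) xs <= bad)%N.
  by apply: sub_count => x /= ltx; rewrite negb_and -ltNge ltx.
have cntr : (count (fun x => (b < x)%R) xs <= bad)%N.
  by apply: sub_count => x /= ltx; rewrite negb_and -!ltNge ltx orbT.
(* Both middle positions have at least [bad] entries before them and at least [bad] after them, for
   either parity of the size. *)
have hb : (bad <= (size xs).-1./2)%N by move: cnt; lia.
have h1 : ((size xs).-1./2 <= (size xs)./2)%N by rewrite half_leq // leq_pred.
have h2 : ((size xs)./2 < size xs)%N by move: cnt; lia.
have h3 : (bad + (size xs)./2 < size xs)%N by move: cnt; lia.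
have l1 : a <= (sort <=%R xs)`_((size xs).-1./2).
  by apply: nth_sort_ge (leq_trans cntl hb); apply: leq_ltn_trans h2.
have l2 : a <= (sort <=%R xs)`_((size xs)./2).
  by apply: nth_sort_ge (leq_trans cntl (leq_trans hb h1)).
have r2 : (sort <=%R xs)`_((size xs)./2) <= b.
  by apply: nth_sort_le; apply: leq_ltn_trans h3; rewrite leq_add2r.
have r1 : (sort <=%R xs)`_((size xs).-1./2) <= b.
  by apply: nth_sort_le; apply: leq_ltn_trans h3; rewrite leq_add.
by rewrite /median; apply/andP; split; lra.
Qed.

End Median.

(** * Finite product measures: factorization, Chebyshev and pools *)

Section ProductMeasure.
Context (R : realType) (S : finType) (p : S -> R).
Hypotheses (p_ge0 : forall x, 0 <= p x) (p_sum1 : \sum_x p x = 1).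

(** With index set ['I_r * 'I_l] this is the weight summed in [sample_prob]; a general [I] also
    covers a single pool. *)
Definition prod_weight (I : finType) (w : {ffun I -> S}) : R := \prod_i p (w i).

Lemma prod_weight_ge0 (I : finType) (w : {ffun I -> S}) : 0 <= prod_weight w.
Proof. exact: prodr_ge0. Qed.

Lemma sum_prod_weight_prod (I : finType) (f : I -> S -> R) :
  \sum_(w : {ffun I -> S}) prod_weight w * \prod_i f i (w i) =
  \prod_i \sum_x p x * f i x.
Proof.
by rewrite bigA_distr_bigA; apply: eq_bigr => w _; rewrite -big_split.
Qed.

Lemma sum_prod_weight (I : finType) :
  \sum_(w : {ffun I -> S}) prod_weight w = 1.
Proof. by rewrite -(bigA_distr_bigA (fun _ : I => p)) big1. Qed.

(** After expansion of the square, independence and mean zero kill the cross terms, and the [#|I|]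
    diagonal terms remain. *)
Lemma variance_sum (I : finType) (Y : S -> R) : \sum_x p x * Y x = 0 ->
  \sum_(w : {ffun I -> S}) prod_weight w * (\sum_i Y (w i)) ^+ 2 =
  #|I|%:R * \sum_x p x * Y x ^+ 2.
Proof.
move=> Y0.
transitivity (\sum_i \sum_j \sum_(w : {ffun I -> S})
    prod_weight w * (Y (w i) * Y (w j))).
  under eq_bigr => w _ do rewrite expr2 mulr_suml mulr_sumr.
  rewrite exchange_big; apply: eq_bigr => i _.
  under eq_bigr => w _ do rewrite mulr_sumr mulr_sumr.
  by rewrite exchange_big.
have mixed i j : i != j ->
    \sum_(w : {ffun I -> S}) prod_weight w * (Y (w i) * Y (w j)) = 0.
  move=> neij.
  (* Padding with factors 1 turns the cross term into a product over all coordinates, so that the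
     expectation factorizes. *)
  pose f k x := (if k == i then Y x else 1) * (if k == j then Y x else 1).
  under eq_bigr => w _.
    rewrite (_ : Y (w i) * Y (w j) = \prod_k f k (w k)); last first.
      by rewrite big_split -!big_mkcond !big_pred1_eq.
    over.
  rewrite sum_prod_weight_prod (bigD1 i) //= /f eqxx (negPf neij).
  by under eq_bigr => x _ do rewrite mulr1; rewrite Y0 mul0r.
have diag i : \sum_(w : {ffun I -> S}) prod_weight w * (Y (w i) * Y (w i)) =
    \sum_x p x * Y x ^+ 2.
  pose f k x := if k == i then Y x ^+ 2 else 1.
  under eq_bigr => w _.
    rewrite (_ : Y (w i) * Y (w i) = \prod_k f k (w k)); last first.
      by rewrite -big_mkcond big_pred1_eq.
    over.
  rewrite sum_prod_weight_prod (bigD1 i) //= /f eqxx.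
  rewrite [X in _ * X]big1 ?mulr1 // => k /negPf->.
  by under eq_bigr => x _ do rewrite mulr1.
under eq_bigr => i _.
  rewrite (bigD1 i) //= diag [X in _ + X]big1 ?addr0; last first.
    by move=> j ji; rewrite mixed // eq_sym.
  over.
by rewrite sumr_const mulr_natl.
Qed.

Lemma chebyshev_mean (l : nat) (X : S -> R) (mu eta : R) :
  (0 < l)%N -> 0 < eta -> \sum_x p x * X x = mu ->
  \sum_(w : {ffun 'I_l -> S} | eta < `|(\sum_j X (w j)) / l%:R - mu|) prod_weight w
  <= (\sum_x p x * (X x - mu) ^+ 2) / (l%:R * eta ^+ 2).
Proof.
move=> l_gt0 eta_gt0 EX; have l0 : 0 < l%:R :> R by rewrite ltr0n.
have le0 : 0 < l%:R * eta :> R by rewrite mulr_gt0.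
have Y0 : \sum_x p x * (X x - mu) = 0.
  under eq_bigr => x _ do rewrite mulrBr.
  by rewrite sumrB -mulr_suml p_sum1 mul1r EX subrr.
have := variance_sum 'I_l Y0; rewrite card_ord; set v := (X in _ = _ * X) => var.
have -> : v / (l%:R * eta ^+ 2) = l%:R * v / (l%:R * eta) ^+ 2.
  by field; rewrite !lt0r_neq0.
rewrite -var mulr_suml big_mkcond; apply: ler_sum => w _.
case: ifPn => [big|_]; last first.
  by rewrite divr_ge0 ?sqr_ge0 // mulr_ge0 ?sqr_ge0 ?prod_weight_ge0.
(* On the event the squared centered sum is at least [(l%:R * eta) ^+ 2], so the normalized square
   dominates the indicator. *)
rewrite -[leRHS]mulrA ler_peMr ?prod_weight_ge0 // ler_pdivlMr ?exprn_gt0 // mul1r.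
have -> : \sum_i (X (w i) - mu) = l%:R * ((\sum_j X (w j)) / l%:R - mu).
  rewrite sumrB sumr_const card_ord -mulr_natl; field; exact: lt0r_neq0.
rewrite -[leRHS]real_normK ?num_real // normrM gtr0_norm //.
rewrite lerXn2r ?nnegrE ?mulr_ge0 ?ltW //.
  exact: lt_trans big.
by rewrite ltr_pM2l.
Qed.

(** Independence of the pools: currying identifies a sample with a family of pools, and the weight
    factorizes accordingly. *)
Lemma sum_prod_weight_pools (I J : finType) (f : I -> {ffun J -> S} -> R) :
  \sum_(w : {ffun I * J -> S}) prod_weight w * \prod_i f i [ffun j => w (i, j)] =
  \prod_i \sum_(v : {ffun J -> S}) prod_weight v * f i v.
Proof.
rewrite bigA_distr_bigA.
pose uncurry (v : {ffun I -> {ffun J -> S}}) := [ffun ij : I * J => v ij.1 ij.2].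
pose curry (w : {ffun I * J -> S}) := [ffun i => [ffun j => w (i, j)]].
have curryK : cancel curry uncurry by move=> w; apply/ffunP => -[i j]; rewrite !ffunE.
have uncurryK : cancel uncurry curry.
  by move=> v; apply/ffunP => i; apply/ffunP => j; rewrite !ffunE.
rewrite (reindex uncurry) /=; last by exists curry => ? _.
apply: eq_bigr => v _; rewrite big_split; congr (_ * _).
  rewrite /prod_weight pair_bigA /=; apply: eq_bigr => -[i j] _.
  by rewrite ffunE.
by apply: eq_bigr => i _; rewrite -[in RHS](uncurryK v) ffunE.
Qed.

(** Union bound over the sets [B] of pools with [2 * #|B| >= r]: all pools of [B] are bad with
    probability at most [64^-#|B| <= 8^-r], and there are at most [2^r] such [B]. *)
Lemma half_pools_bad (r l : nat) (bad : pred {ffun 'I_l -> S}) :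
  \sum_(v | bad v) prod_weight v <= 64^-1 ->
  \sum_(w : {ffun 'I_r * 'I_l -> S} |
      (r <= #|[set i : 'I_r | bad [ffun j => w (i, j)]]|.*2)%N) prod_weight w
  <= 4^-1 ^+ r.
Proof.
move=> bad_le.
(* The product of [ind B i] over [i] is the indicator that every pool in [B] is bad. *)
pose ind (B : {set 'I_r}) i v : R := if i \in B then (bad v)%:R else 1.
have sumB (B : {set 'I_r}) : (r <= #|B|.*2)%N ->
    \sum_(w : {ffun 'I_r * 'I_l -> S})
      prod_weight w * \prod_i ind B i [ffun j => w (i, j)] <= 8^-1 ^+ r.
  move=> leB; rewrite sum_prod_weight_pools.
  apply: (@le_trans _ _ (\prod_(i in B) 64^-1)).
    rewrite [leRHS]big_mkcond; apply: ler_prod => i _; apply/andP; split.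
      apply: sumr_ge0 => v _; rewrite mulr_ge0 ?prod_weight_ge0 // /ind.
      by case: ifP.
    rewrite /ind; case: ifP => _.
      apply: le_trans bad_le; rewrite [leRHS]big_mkcond.
      by apply: ler_sum => v _; case: (bad v); rewrite ?mulr1 ?mulr0.
    by under eq_bigr => v _ do rewrite mulr1; rewrite sum_prod_weight.
  rewrite prodr_const (_ : 64^-1 = 8^-1 ^+ 2 :> R); last by field.
  by rewrite -exprM mul2n ler_wiXn2l ?invr_ge0 ?invf_le1 ?ler1n ?ler0n ?ltr0n.
apply: (@le_trans _ _ (\sum_(B : {set 'I_r}) 8^-1 ^+ r)); last first.
  rewrite sumr_const -cardsT -powersetT card_powerset cardsT card_ord.
  rewrite -[leLHS]mulr_natl natrX -exprMn.
  by rewrite (_ : 2 * 8^-1 = 4^-1 :> R) //; field.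
apply: (@le_trans _ _ (\sum_(B : {set 'I_r} | (r <= #|B|.*2)%N)
    \sum_(w : {ffun 'I_r * 'I_l -> S})
      prod_weight w * \prod_i ind B i [ffun j => w (i, j)])); last first.
  rewrite big_mkcond; apply: ler_sum => B _; case: ifP => [/sumB //|_].
  by rewrite exprn_ge0 ?invr_ge0 ?ler0n.
rewrite exchange_big big_mkcond; apply: ler_sum => w _.
have ind_ge0 B : 0 <= prod_weight w * \prod_i ind B i [ffun j => w (i, j)].
  rewrite mulr_ge0 ?prod_weight_ge0 ?prodr_ge0 // => i _; rewrite /ind.
  by case: ifP.
case: ifP => [big|_]; last by apply: sumr_ge0 => *; apply: ind_ge0.
(* The term where [B] is exactly the set of bad pools already contributes the full weight of [w]. *)
rewrite (bigD1 _ big) /= big1 ?mulr1 => [|i _]; last first.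
  by rewrite /ind inE; case: ifP => [->|].
by rewrite lerDl sumr_ge0 // => *; apply: ind_ge0.
Qed.

End ProductMeasure.

(** * Union bound, counting of small sets and a numerical estimate *)

Lemma sum_exists_le (R : numDomainType) (I J : finType) (a : I -> R)
    (Q : pred J) (P : J -> pred I) :
  (forall i, 0 <= a i) ->
  \sum_(i | [exists (j | Q j), P j i]) a i <= \sum_(j | Q j) \sum_(i | P j i) a i.
Proof.
move=> a_ge0; rewrite (exchange_big_dep predT) //= big_mkcond.
apply: ler_sum => i _; case: ifP => [|_]; last exact: sumr_ge0.
case/existsP => j QPj.
by rewrite (bigD1 j) //= lerDl sumr_ge0.
Qed.

(** Every such set is the image of a map ['I_s -> V]: list its elements and pad with one of them,
    which exists by nonemptiness. *)
Lemma card_small_sets (V : finType) s :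
  (#|[set T : {set V} | (T != set0) && (#|T| <= s)%N]| <= #|V| ^ s)%N.
Proof.
rewrite -[s in (_ ^ s)%N]card_ord -card_ffun -cardsT.
apply: leq_trans (leq_imset_card (fun f : {ffun 'I_s -> V} => [set f i | i : 'I_s]) _).
apply/subset_leq_card/subsetP => T; rewrite inE => /andP[/set0Pn[x0 x0T] cT].
apply/imsetP; exists [ffun i : 'I_s => nth x0 (enum T) i]; first by rewrite inE.
apply/setP => x; apply/idP/imsetP => [xT|[i _ ->]].
  have lt : (index x (enum T) < s)%N.
    by rewrite (leq_trans _ cT) // cardE index_mem mem_enum.
  by exists (Ordinal lt); rewrite ?inE // ffunE /= nth_index ?mem_enum.
rewrite ffunE; have [lti|gei] := ltnP i (size (enum T)).
  by rewrite -mem_enum mem_nth.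
by rewrite nth_default.
Qed.

(** Square the bound [expR (- 1/2) >= 1 - 1/2]. *)
Lemma expR_quarter (R : realType) : 4^-1 <= expR (- 1) :> R.
Proof.
have -> : - 1 = 2%:R * - 2^-1 :> R by field.
rewrite expRM_natl (_ : 4^-1 = 2^-1 ^+ 2 :> R); last by field.
rewrite lerXn2r ?nnegrE ?expR_ge0 ?invr_ge0 ?ler0n //.
by apply: le_trans (expR_ge1Dx _); lra.
Qed.

(** * Oracle accuracy on a fixed set, and its consequence for greedy *)

Section Concentration.
Context (R : realType) (V : finType) (G : sdm R V) (tau : nat).
Variables (r l : nat) (eta : R).

Lemma sdm_prob_oracle_inaccurate (T : {set V}) :
  (0 < l)%N -> 0 < eta ->
  sim_variance G (reward G tau T) <= 64^-1 * (l%:R * eta ^+ 2) ->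
  \sum_(w : sample V r l |
      eta < `|oracle G tau w T - influence G tau T|) prod_weight (sdm_pmf G) w
  <= 4^-1 ^+ r.
Proof.
move=> l_gt0 eta_gt0 var_le; set mu := influence G tau T.
pose bad (v : {ffun 'I_l -> simulation V}) :=
  eta < `|(\sum_j reward G tau T (v j)) / l%:R - mu|.
have bad_le : \sum_(v | bad v) prod_weight (sdm_pmf G) v <= 64^-1.
  apply: le_trans (chebyshev_mean (sdm_pmf_ge0 G) (sdm_pmf_sum1 G) l_gt0
    eta_gt0 erefl) _.
  by rewrite ler_pdivrMr // mulr_gt0 ?ltr0n // exprn_gt0.
apply: le_trans (half_pools_bad (sdm_pmf_ge0 G) (sdm_pmf_sum1 G) r bad_le).
rewrite big_mkcond [leRHS]big_mkcond; apply: ler_sum => w _.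
case: ifPn => [|_]; last by case: ifP => // _; exact/prod_weight_ge0/sdm_pmf_ge0.
(* By contraposition: with fewer than half of the pools bad, the median stays within [eta] of
   [mu]. *)
rewrite ltNge => far; case: ifPn => //; rewrite -ltnNge => few; case/negP: far.
rewrite ler_distl; apply: median_between.
rewrite size_map -cardE card_ord; apply: leq_ltn_trans few.
rewrite leq_double count_map -size_filter cardE.
apply: uniq_leq_size => [|i]; first by rewrite filter_uniq ?enum_uniq.
rewrite mem_filter !mem_enum !inE /= -ler_distl -ltNge => /andP[+ _].
by rewrite /bad => far; under eq_bigr => j _ do rewrite ffunE.
Qed.

Lemma greedy_oracle_approx (s : nat) (eps : R) (w : sample V r l) (T : {set V}) :
  submodular (influence G tau) -> (0 < s)%N -> 0 < eps ->
  (forall A : {set V}, A != set0 -> (#|A| <= s)%N ->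
    `|oracle G tau w A - influence G tau A| <= eps * opt G tau s / (2 * s%:R)) ->
  greedy_set (oracle G tau w) s T ->
  (1 - (1 - s%:R^-1) ^+ s) * (1 - eps) * opt G tau s <= influence G tau T.
Proof.
move=> subI s_gt0 eps_gt0 acc gT.
have opt_ge0 : 0 <= opt G tau s by exact: bigmax_ge_id.
have s0 : 0 < s%:R :> R by rewrite ltr0n.
set e := eps * opt G tau s / (2 * s%:R) in acc.
have e_ge0 : 0 <= e by rewrite divr_ge0 ?mulr_ge0 ?ler0n // ltW.
have approx (O : {set V}) : (#|O| <= s)%N ->
    (1 - (1 - s%:R^-1) ^+ s) * (influence G tau O - 2 * s%:R * e)
    <= influence G tau T.
  exact: (greedy_approx subI (@influence_mono _ _ G tau)
    (@influence_ge0 _ _ G tau) s_gt0 e_ge0 acc (leqnn s) gT).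
have -> : (1 - (1 - s%:R^-1) ^+ s) * (1 - eps) * opt G tau s =
    (1 - (1 - s%:R^-1) ^+ s) * (opt G tau s - 2 * s%:R * e).
  by rewrite /e; field; rewrite lt0r_neq0.
(* The bound passes from each feasible [O] to the maximum. The default value 0 is covered by
   [O = set0], whose influence is nonnegative. *)
rewrite {1}/opt; elim/big_ind: _ => [|x y hx hy|O /approx//].
  have := approx set0; rewrite cards0 => /(_ isT).
  apply: le_trans; rewrite ler_wpM2l ?lerD2r ?influence_ge0 //.
  rewrite subr_ge0 exprn_ile1 ?subr_ge0 ?invf_le1 ?ler1n // gerBl invr_ge0.
  exact: ler0n.
by case: (leP x y).
Qed.

End Concentration.

Theorem theorem8p1 :
  exists C1 C2 : nat, (0 < C1)%N /\ (0 < C2)%N /\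
  forall (R : realType) (V : finType) (G : sdm R V) (tau : nat)
         (c eps delta : R) (s r l : nat),
    submodular (influence G tau) ->
    1 <= c ->
    (forall T : {set V},
       sim_variance G (reward G tau T) <=
         c * influence G tau T *
           Num.max (influence G tau T) (max_influence1 G tau)) ->
    0 < eps -> eps < 1 ->
    0 < delta -> delta < 1 ->
    (1 <= s)%N -> (s <= #|V|)%N ->
    C1%:R * (s%:R * ln (#|V|%:R / delta)) <= r%:R ->
    C2%:R * (eps ^- 2 * s%:R ^+ 2 * c) <= l%:R ->
    1 - delta <=
      sample_prob G (fun w : sample V r l =>
        forall T : {set V}, greedy_set (oracle G tau w) s T ->
          (1 - (1 - s%:R^-1) ^+ s) * (1 - eps) * opt G tau s <=
            influence G tau T).
Proof.
(* 256 is 64, from the Chebyshev bound [1/64], times the 4 in the square of [2 * s]; 1 suffices for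
   the pools because [4^-r <= expR (- r)]. *)
exists 1%N, 256%N; split=> //; split=> //.
move=> R V G tau c eps delta s r l subI c_ge1 var_le eps_gt0 eps_lt1 d_gt0 d_lt1.
move=> s_gt0 s_le_n r_ge l_ge; rewrite /sample_prob.
pose E (w : sample V r l) := forall T : {set V},
  greedy_set (oracle G tau w) s T ->
  (1 - (1 - s%:R^-1) ^+ s) * (1 - eps) * opt G tau s <= influence G tau T.
have w_ge0 (w : sample V r l) : 0 <= prod_weight (sdm_pmf G) w.
  exact/prod_weight_ge0/sdm_pmf_ge0.
have s0 : 0 < s%:R :> R by rewrite ltr0n.
have n0 : 0 < #|V|%:R :> R by rewrite ltr0n (leq_trans s_gt0).
have opt_ge0 : 0 <= opt G tau s by exact: bigmax_ge_id.
have := sum_prod_weight (sdm_pmf_sum1 G) ('I_r * 'I_l)%type.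
rewrite (bigID (fun w => `[< E w >])) /= => total.
suff : \sum_(w : sample V r l | ~~ `[< E w >]) prod_weight (sdm_pmf G) w <= delta.
  by move=> tail; rewrite lerBlDr -[leLHS]total; apply: lerD.
(* Chebyshev needs a positive tolerance, so OPT = 0 is split off; there the guarantee only says that
   influence is nonnegative. *)
have [opt_le0|opt_gt0] := leP (opt G tau s) 0.
  rewrite big_pred0 ?ltW // => w; apply/negbTE; rewrite negbK; apply/asboolP => T _.
  have -> : opt G tau s = 0 by apply/le_anti; rewrite opt_le0.
  by rewrite mulr0 influence_ge0.
set e := eps * opt G tau s / (2 * s%:R).
have e_gt0 : 0 < e by rewrite divr_gt0 ?mulr_gt0.
have l0 : 0 < l%:R :> R.
  apply: lt_le_trans l_ge.
  by rewrite !mulr_gt0 ?invr_gt0 ?exprn_gt0 // (lt_le_trans ltr01).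
have l_gt0 : (0 < l)%N by rewrite ltr0n in l0.
pose small (T : {set V}) := (T != set0) && (#|T| <= s)%N.
pose far (T : {set V}) (w : sample V r l) :=
  e < `|oracle G tau w T - influence G tau T|.
have far_le T : small T ->
    \sum_(w | far T w) prod_weight (sdm_pmf G) w <= 4^-1 ^+ r.
  move=> /andP[_ cT]; apply: sdm_prob_oracle_inaccurate => //.
  apply: le_trans (var_le T) _.
  have I_le := influence_le_opt G tau cT.
  have c_ge0 : 0 <= c by exact: le_trans c_ge1.
  apply: (@le_trans _ _ (c * opt G tau s * opt G tau s)).
    apply: ler_pM; rewrite ?mulr_ge0 ?influence_ge0 ?le_max ?influence_ge0 //.
      by rewrite ler_wpM2l.
    by rewrite ge_max I_le max_influence1_le_opt.
  apply: (@le_trans _ _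
      (64^-1 * (256 * (eps ^- 2 * s%:R ^+ 2 * c) * e ^+ 2))); last first.
    by rewrite ler_wpM2l ?invr_ge0 ?ler0n // ler_wpM2r ?sqr_ge0.
  rewrite le_eqVlt; apply/orP; left; apply/eqP; rewrite /e.
  by field; rewrite !lt0r_neq0.
apply: (@le_trans _ _ (\sum_(w | [exists (T | small T), far T w])
    prod_weight (sdm_pmf G) w)).
  (* A sample on which greedy fails must be inaccurate on some small set. *)
  rewrite big_mkcond [leRHS]big_mkcond; apply: ler_sum => w _.
  case: ifPn => [notE|_]; last by case: ifP.
  case: ifPn => // /existsPn close; case/negP: notE; apply/asboolP => T.
  apply: greedy_oracle_approx => // A A0 cA.
  by have := close A; rewrite /small A0 cA /= /far -leNgt.
apply: le_trans (sum_exists_le _ _ w_ge0) _.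
apply: (@le_trans _ _ (#|[set T : {set V} | small T]|%:R * 4^-1 ^+ r)).
  by rewrite cardsE mulr_natl -sumr_const; apply: ler_sum.
have r_tail : 4^-1 ^+ r <= (delta / #|V|%:R) ^+ s.
  apply: (@le_trans _ _ (expR (- 1) ^+ r)).
    by rewrite lerXn2r ?nnegrE ?invr_ge0 ?ler0n ?expR_ge0 ?expR_quarter.
  rewrite -expRM_natl mulrN1.
  have -> : (delta / #|V|%:R) ^+ s = expR (- (s%:R * ln (#|V|%:R / delta))).
    by rewrite expRN expRM_natl lnK ?posrE ?divr_gt0 // -exprVn invf_div.
  by rewrite ler_expR lerN2 -[leLHS]mul1r.
apply: (@le_trans _ _ (#|V|%:R ^+ s * (delta / #|V|%:R) ^+ s)).
  apply: ler_pM r_tail; rewrite ?exprn_ge0 ?invr_ge0 ?ler0n //.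
  by rewrite -natrX ler_nat card_small_sets.
(* The product is [delta ^+ s], at most [delta] because [s >= 1] and [delta < 1]. *)
rewrite -exprMn mulrCA mulfV ?lt0r_neq0 // mulr1.
by rewrite -[leRHS]expr1 ler_wiXn2l ?ltW.
Qed.
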